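(* Let $T:C\to C$ be a nonexpansive map on a totally bounded subset $C$ of a Banach space, let $x\in C$, and let $(\varepsilon,g)\mapsto\Gamma(\varepsilon,g)\in\mathbb N$ be a map such that for every $\varepsilon>0$ and every $g:\mathbb N\to\mathbb N$ one has $$\|T^{g(j)}x-T^{g(i)}x\|<\varepsilon\quad\text{for some } i\leq\Gamma(\varepsilon,g)\text{ and some } j>i.$$ Then for every $\varepsilon>0$ and $g:\mathbb N\to\mathbb N$ there is an $N\leq A_2(\varepsilon,g)$ such that $$|\alpha_m^i-\alpha_n^i|<\varepsilon\quad\text{for all } m,n\in[N,N+g(N)]\text{ and all } i\in\mathbb N.$$
   Context: $\mathbb N=\{0,1,2,\dots\}$, and $[m,n]$ denotes the set of natural numbers $k$ with $m\le k\le n$. Nonexpansive means $\|Ty-Tz\|\le\|y-z\|$ for all $y,z\in C$. Put $\alpha^i_n:=\|T^nx-T^{n+i}x\|$ for $i,n\in\mathbb N$. For $g:\mathbb N\to\mathbb N$ define $\widetilde g(n):=n+g(n)$, with iterates $\widetilde g^0(n):=n$ and $\widetilde g^{i+1}(n):=\widetilde g(\widetilde g^i(n))$. For $\varepsilon>0$ and $g:\mathbb N\to\mathbb N$ put $$A_2(\varepsilon,g):=\widetilde g^K(0)\quad\text{with}\quad K:=\Gamma\left(\tfrac{\varepsilon}{2},\,l\mapsto\widetilde g^l(0)\right).$$ *)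

(* Defs.v *)
From HB Require Import structures.
From mathcomp Require Import all_boot all_order all_algebra.
From mathcomp Require Import all_classical all_reals all_analysis.

Set Implicit Arguments.
Unset Strict Implicit.
Unset Printing Implicit Defensive.

Import Order.TTheory GRing.Theory Num.Theory.
Import numFieldNormedType.Exports.

Local Open Scope classical_set_scope.
Local Open Scope ring_scope.

Definition totally_bounded (R : realType) (V : normedModType R) (C : set V)
    : Prop :=
  forall e : R, 0 < e ->
    exists s : set V,
      [/\ finite_set s, s `<=` C & C `<=` \bigcup_(a in s) ball a e].

Definition nonexpansive_on (R : realType) (V : normedModType R) (C : set V)
    (T : V -> V) : Prop :=
  forall y z : V, C y -> C z -> `|T y - T z| <= `|y - z|.

Definition alpha (R : realType) (V : normedModType R) (T : V -> V) (x : V)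
    (i n : nat) : R :=
  `|iter n T x - iter (n + i) T x|.

Definition gtilde (g : nat -> nat) (n : nat) : nat := (n + g n)%N.

(* [Gamma] is only meaningful at positive first arguments; its values elsewhere
   are irrelevant. *)
Definition A2 (R : realType) (Gamma : R -> (nat -> nat) -> nat)
    (eps : R) (g : nat -> nat) : nat :=
  let K := Gamma (eps / 2) (fun l => iter l (gtilde g) 0%N) in
  iter K (gtilde g) 0%N.

(* Main.v *)
(** Nonexpansiveness makes each sequence [n |-> alpha i n] nonincreasing, and
    lets [alpha i] vary between two times [N] and [M] by at most twice the
    distance of the orbit points at those times. Applying [Gamma] to the
    sequence of iterates of [gtilde g] at [0] yields [N] and [M] with
    [N + g N <= M] whose orbit points are [eps / 2]-close; monotonicity then
    confines [alpha i] on [N, ..., N + g N] to an interval of length [< eps]. *)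
Require Import Defs.
From HB Require Import structures.
From mathcomp Require Import all_boot all_order all_algebra.
From mathcomp Require Import all_classical all_reals all_analysis.
From mathcomp Require Import lra.

Import Order.TTheory GRing.Theory Num.Theory.
Import numFieldNormedType.Exports.

Local Open Scope classical_set_scope.
Local Open Scope ring_scope.

Section NonexpansiveOrbit.
Context {R : realType} {V : normedModType R} {C : set V} {T : V -> V} {x : V}.
Hypotheses (CT : forall y, C y -> C (T y)) (hT : nonexpansive_on C T).
Hypothesis (hx : C x).

Lemma iter_stable (n : nat) : C (iter n T x).
Proof. by elim: n => //= n /CT. Qed.

Lemma orbit_dist_addn (i m n : nat) :
  `|iter (m + i) T x - iter (n + i) T x| <= `|iter m T x - iter n T x|.
Proof.
elim: i => [|i IHi]; first by rewrite !addn0.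
rewrite !addnS /=; apply: le_trans IHi.
by apply: hT; exact: iter_stable.
Qed.

Lemma alpha_nonincreasing (i m n : nat) :
  (m <= n)%N -> alpha T x i n <= alpha T x i m.
Proof.
(* [addnAC] exposes [n - m] as a common shift of both orbit indices. *)
move=> /subnKC <-; rewrite /alpha addnAC.
exact: orbit_dist_addn.
Qed.

(** Go from [iter m T x] to [iter (m + i) T x] through [iter n T x] and [iter (n + i) T x]: the
    middle leg is [alpha T x i n], and shifting by [i] makes the last leg no longer than the
    first. *)
Lemma alpha_dist (i m n : nat) :
  alpha T x i m - alpha T x i n <= `|iter n T x - iter m T x| *+ 2.
Proof.
rewrite lerBlDr /alpha.
have -> : iter m T x - iter (m + i) T x =
    (iter m T x - iter n T x) + (iter n T x - iter (n + i) T x) +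
    (iter (n + i) T x - iter (m + i) T x) by rewrite !subrKA.
rewrite mulr2n [leRHS]addrAC; apply: le_trans (ler_normD _ _) _.
apply: lerD; last exact: orbit_dist_addn.
by rewrite (distrC (iter n T x)) ler_normD.
Qed.

End NonexpansiveOrbit.

Lemma leq_iter_gtilde (g : nat -> nat) (a i j : nat) :
  (i <= j)%N -> (iter i (gtilde g) a <= iter j (gtilde g) a)%N.
Proof.
move=> /subnKC <-; elim: (j - i)%N => [|k IHk]; first by rewrite addn0.
by rewrite addnS; apply: leq_trans IHk _; exact: leq_addr.
Qed.

Theorem proposition5p6 (R : realType) (V : completeNormedModType R)
    (C : set V) (T : {fun C >-> C}) (x : V)
    (Gamma : R -> (nat -> nat) -> nat)
    (hC : totally_bounded C)
    (hT : nonexpansive_on C T)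
    (hx : C x)
    (hGamma : forall (eps : R) (g : nat -> nat), 0 < eps ->
      exists i j : nat,
        [/\ (i <= Gamma eps g)%N, (i < j)%N &
            `|iter (g j) T x - iter (g i) T x| < eps]) :
  forall (eps : R) (g : nat -> nat), 0 < eps ->
    exists N : nat, (N <= A2 Gamma eps g)%N /\
      forall m n : nat,
        (N <= m <= N + g N)%N -> (N <= n <= N + g N)%N ->
        forall i : nat, `|alpha T x i m - alpha T x i n| < eps.
Proof.
move=> eps g eps0.
have CT y : C y -> C (T y) by exact: funS.
(* The positivity proof sets the tolerance to [eps / 2], offsetting the factor 2 in [alpha_dist]. *)
have [i [j [iK ij close]]] := hGamma _ (fun l => iter l (gtilde g) 0%N)
  (divr_gt0 eps0 (ltr0n R 2)).
set N := iter i (gtilde g) 0%N in close.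
set M := iter j (gtilde g) 0%N in close.
exists N; split; first exact: leq_iter_gtilde.
(* [N + g N] is by conversion the iterate of index [i.+1], and [i < j]. *)
have NgM : (N + g N <= M)%N by exact: (leq_iter_gtilde g 0 i.+1).
move=> m n /andP[Nm mN] /andP[Nn nN] k.
have lo p : (p <= N + g N)%N -> alpha T x k M <= alpha T x k p.
  by move=> pN; apply: (alpha_nonincreasing CT hT hx); exact: leq_trans NgM.
have hi p : (N <= p)%N -> alpha T x k p <= alpha T x k N.
  exact: (alpha_nonincreasing CT hT hx).
have := alpha_dist CT hT hx k N M.
have := lo m mN; have := lo n nN; have := hi m Nm; have := hi n Nn.
by rewrite ltr_norml mulr2n; move: close => *; apply/andP; split; lra.
Qed.
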